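(* Let $F$ be a field and let $A=F\langle x_1,\dots,x_m\rangle/\langle w_1,\dots,w_r\rangle$ be a finitely presented monomial algebra. Let $a_n(A)$ be the number of irreducible components of $\mathcal P_n(A)$ and $\bar a_n(A)$ the number of irreducible components of $\overline{\mathcal P}_n(A)$. Then the generating functions $\sum_{n=0}^\infty a_n(A)t^n$ and $\sum_{n=0}^\infty\bar a_n(A)t^n$ are rational functions.
   Context: A monomial algebra is a quotient of a free associative algebra $F\langle x_1,\dots,x_m\rangle$ by an ideal generated by monomials (here finitely many monomials $w_1,\dots,w_r$), graded by $\deg x_i=1$. A point module is a graded cyclic right $A$-module $P=\bigoplus_{n\ge0}P_n$ generated in degree $0$ with all $\dim_F P_n=1$. Writing $P_i=Fe_i$, $e_i\cdot x_j=\lambda_{i,j}e_{i+1}$, its isomorphism class is recorded by $(\underline\lambda_0,\underline\lambda_1,\dots)\in\mathbb P^{m-1}\times\mathbb P^{m-1}\times\cdots$ with $\underline\lambda_i=[\lambda_{i,1}:\cdots:\lambda_{i,m}]$. $\mathcal P_n(A)\subseteq(\mathbb P^{m-1})^{\times(n+1)}$ is the projective variety of all $(\underline\lambda_0,\dots,\underline\lambda_n)$ that are initial segments of such sequences coming from point modules (truncations of point modules). $\overline{\mathcal P}_n(A)\subseteq(\mathbb P^{m-1})^{\times(n+1)}$ is the (possibly larger) projective variety of all $(\underline\lambda_0,\dots,\underline\lambda_n)$ arising from graded cyclic right modules $M=Fe_0+\cdots+Fe_{n+1}$ generated by $e_0$ in degree $0$ with one-dimensional components in degrees $0,\dots,n+1$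 and zero in higher degrees, via $e_i\cdot x_j=\lambda_{i,j}e_{i+1}$; i.e. the moduli space of truncated point modules, which need not extend to point modules. Both are regarded as algebraic varieties (if $F$ is not algebraically closed, their points are taken over all extension fields $K/F$, using $A\otimes_FK$), and irreducible components are meant in this sense. *)

(* Defs.v *)
From HB Require Import structures.
From mathcomp Require Import all_boot all_order all_algebra.
From mathcomp Require Import boolp.
From mathcomp Require Import monalg.
From mathcomp Require Import mpoly.

Set Implicit Arguments.
Unset Strict Implicit.
Unset Printing Implicit Defensive.

Import GRing.Theory.
Local Open Scope ring_scope.
Local Open Scope quotient_scope.

(* {fmonom 'I_m} is the free monoid on x_0, ..., x_(m-1); its monoid algebra   *)
(* is the free associative algebra K<x_0, ..., x_(m-1)>.                       *)
Notation free_alg K m := {malg K[{fmonom 'I_m}]}.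

Section MonomialIdeal.
Context (K : fieldType) (m : nat) (ws : seq {fmonom 'I_m}).

Definition in_monomial_ideal (f : free_alg K m) : Prop :=
  exists s : seq (free_alg K m * {fmonom 'I_m} * free_alg K m),
    {in s, forall t, t.1.2 \in ws} /\
    f = \sum_(t <- s) t.1.1 * << t.1.2 >> * t.2.

Definition monomial_ideal : {pred free_alg K m} :=
  fun f => `[< in_monomial_ideal f >].

Lemma monomial_idealP f :
  reflect (in_monomial_ideal f) (f \in monomial_ideal).
Proof. exact: asboolP. Qed.

Lemma monomial_ideal_zmod : zmod_closed monomial_ideal.
Proof.
split; first by apply/monomial_idealP; exists [::]; rewrite big_nil.
move=> f g /monomial_idealP [s [sP ->]] /monomial_idealP [t [tP ->]].
apply/monomial_idealP.
exists (s ++ [seq (- u.1.1, u.1.2, u.2) | u <- t]); split.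
  move=> u; rewrite mem_cat => /orP [/sP //|/mapP [v /tP vP ->]]; exact: vP.
rewrite big_cat big_map /=; congr (_ + _).
by rewrite -sumrN; apply: eq_bigr => u _; rewrite !mulNr.
Qed.

HB.instance Definition _ := GRing.isZmodClosed.Build (free_alg K m)
  monomial_ideal monomial_ideal_zmod.

Lemma monomial_idealMl f g :
  g \in monomial_ideal -> f * g \in monomial_ideal.
Proof.
move=> /monomial_idealP [s [sP ->]]; apply/monomial_idealP.
exists [seq (f * u.1.1, u.1.2, u.2) | u <- s]; split.
  by move=> u /mapP [v /sP vP ->].
by rewrite big_map mulr_sumr; apply: eq_bigr => u _; rewrite !mulrA.
Qed.

Lemma monomial_idealMr f g :
  f \in monomial_ideal -> f * g \in monomial_ideal.
Proof.
move=> /monomial_idealP [s [sP ->]]; apply/monomial_idealP.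
exists [seq (u.1.1, u.1.2, u.2 * g) | u <- s]; split.
  by move=> u /mapP [v /sP vP ->].
by rewrite big_map mulr_suml; apply: eq_bigr => u _; rewrite !mulrA.
Qed.

(* K<x_0, ..., x_(m-1)> / <ws>. For an extension K/F it is the base change to  *)
(* K of the monomial algebra over F with the same relations.                   *)
Definition monomial_algebra :=
  Quotient.quot (GRing.ZmodClosed.clone (free_alg K m) monomial_ideal _).
HB.instance Definition _ := GRing.Zmodule.on monomial_algebra.

Definition mon_pi (f : free_alg K m) : monomial_algebra := \pi_monomial_algebra f.

Definition mon_one : monomial_algebra := mon_pi 1.
Definition mon_mul (a b : monomial_algebra) : monomial_algebra :=
  mon_pi (repr a * repr b).

Lemma mon_pi_eq f g : (mon_pi f == mon_pi g) = (f - g \in monomial_ideal).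
Proof. by rewrite /mon_pi Quotient.idealrBE. Qed.

Lemma mon_piK a : mon_pi (repr a) = a.
Proof. exact: reprK. Qed.

Lemma mon_piD : {morph mon_pi : f g / f + g}.
Proof. by move=> f g; rewrite /mon_pi !piE. Qed.

Lemma mon_piM f g : mon_pi (f * g) = mon_mul (mon_pi f) (mon_pi g).
Proof.
apply/eqP; rewrite mon_pi_eq.
set f' := repr _; set g' := repr _.
have -> : f * g - f' * g' = (f - f') * g + f' * (g - g').
  by rewrite mulrBl mulrBr addrA addrNK.
apply: rpredD; [apply: monomial_idealMr|apply: monomial_idealMl].
all: by rewrite -mon_pi_eq mon_piK.
Qed.

Lemma mon_mulA : associative mon_mul.
Proof.
by move=> a b c; rewrite -[a]mon_piK -[b]mon_piK -[c]mon_piK -!mon_piM mulrA.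
Qed.
Lemma mon_mul1l : left_id mon_one mon_mul.
Proof. by move=> a; rewrite -[a]mon_piK -mon_piM mul1r. Qed.
Lemma mon_mul1r : right_id mon_one mon_mul.
Proof. by move=> a; rewrite -[a]mon_piK -mon_piM mulr1. Qed.
Lemma mon_mulDl : left_distributive mon_mul +%R.
Proof.
move=> a b c; rewrite -[a]mon_piK -[b]mon_piK -[c]mon_piK.
by rewrite -mon_piD -!mon_piM -mon_piD mulrDl.
Qed.
Lemma mon_mulDr : right_distributive mon_mul +%R.
Proof.
move=> a b c; rewrite -[a]mon_piK -[b]mon_piK -[c]mon_piK.
by rewrite -mon_piD -!mon_piM -mon_piD mulrDr.
Qed.

(* Possibly the zero ring (when the empty word is a relation), hence pzRing.   *)
HB.instance Definition _ := GRing.Zmodule_isPzRing.Build monomial_algebra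
  mon_mulA mon_mul1l mon_mul1r mon_mulDl mon_mulDr.

Definition mon_scal (c : K) : monomial_algebra := mon_pi c%:A.
Definition mon_gen (j : 'I_m) : monomial_algebra := mon_pi << fmu j >>.

Definition homogeneous (d : nat) (a : monomial_algebra) : Prop :=
  exists2 f : free_alg K m,
    (forall w, monalg.mcoeff w f != 0 -> size w = d) & a = mon_pi f.

End MonomialIdeal.

(* A right module is a left module over the opposite ring.                     *)
Notation rmodType A := (lmodType A^c).
Definition ract (A : pzRingType) (M : rmodType A) (v : M) (a : A) : M :=
  (a : A^c) *: v.
Local Notation "v *> a" := (ract v a) (at level 40, left associativity).

Section GradedModules.
Context (K : fieldType) (m : nat) (ws : seq {fmonom 'I_m}).
Local Notation A := (monomial_algebra K ws).

(* M is the internal direct sum of the subspaces Mg d, d >= 0, and             *)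
(* Mg d . A_e is contained in Mg (d + e).                                      *)
Record is_grading (M : rmodType A) (Mg : nat -> M -> Prop) : Prop := {
  gr_zero : forall d, Mg d 0;
  gr_add : forall d u v, Mg d u -> Mg d v -> Mg d (u + v);
  gr_act : forall d e v (a : A), Mg d v -> homogeneous e a -> Mg (d + e)%N (v *> a);
  gr_sum : forall v, exists N (u : nat -> M),
    (forall i, Mg i (u i)) /\ v = \sum_(i < N) u i;
  gr_direct : forall N (u : nat -> M), (forall i, Mg i (u i)) ->
    \sum_(i < N) u i = 0 -> forall i, (i < N)%N -> u i = 0 }.

Definition generated_in_degree0 (M : rmodType A) (Mg : nat -> M -> Prop) : Prop :=
  exists2 e : M, Mg 0%N e & forall v, exists a : A, v = e *> a.

Definition spans_line (M : rmodType A) (U : M -> Prop) (e : M) : Prop :=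
  [/\ U e, e <> 0 & forall v, U v -> exists c : K, v = e *> mon_scal ws c].

Definition is_point_module (M : rmodType A) (Mg : nat -> M -> Prop) : Prop :=
  [/\ is_grading Mg, generated_in_degree0 Mg &
      forall d, exists e, spans_line (Mg d) e].

(* Nonzero exactly in degrees 0, ..., n.+1.                                    *)
Definition is_truncated_point_module (n : nat)
    (M : rmodType A) (Mg : nat -> M -> Prop) : Prop :=
  [/\ is_grading Mg, generated_in_degree0 Mg,
      forall d, (d <= n.+1)%N -> exists e, spans_line (Mg d) e &
      forall d v, (n.+1 < d)%N -> Mg d v -> v = 0].

End GradedModules.

(* The projective space P^(m-1)(K), as the set of lines through 0 in K^m.      *)
Definition proj_space (K : fieldType) (m : nat) : Type :=
  {L : {vspace 'rV[K]_m} | \dim L == 1%N}.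

Definition hom_coords (K : fieldType) (m : nat)
    (v : 'rV[K]_m) (L : proj_space K m) : Prop :=
  <[v]>%VS = val L.

Section PointVarieties.
Context (K : fieldType) (m : nat) (ws : seq {fmonom 'I_m}).
Local Notation A := (monomial_algebra K ws).

(* L has homogeneous coordinates lambda with e_i . x_j = lambda_j e_(i+1).     *)
Definition step_recorded (M : rmodType A) (e : nat -> M) (i : nat)
    (L : proj_space K m) : Prop :=
  exists2 lambda : 'rV[K]_m, hom_coords lambda L &
    forall j, e i *> mon_gen K ws j = e i.+1 *> mon_scal ws (lambda 0 j).

Definition recorded_by (M : rmodType A) (Mg : nat -> M -> Prop)
    (L : nat -> proj_space K m) : Prop :=
  exists e : nat -> M,
    (forall i, spans_line (Mg i) (e i)) /\ forall i, step_recorded e i (L i).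

Definition truncation_recorded_by (n : nat) (M : rmodType A)
    (Mg : nat -> M -> Prop) (L : {ffun 'I_n.+1 -> proj_space K m}) : Prop :=
  exists e : nat -> M,
    (forall i, (i <= n.+1)%N -> spans_line (Mg i) (e i)) /\
    forall i : 'I_n.+1, step_recorded e i (L i).

Definition extends_to_point_module (n : nat)
    (L : {ffun 'I_n.+1 -> proj_space K m}) : Prop :=
  exists (M : rmodType A) (Mg : nat -> M -> Prop) (S : nat -> proj_space K m),
    [/\ is_point_module Mg, recorded_by Mg S & forall i : 'I_n.+1, L i = S i].

Definition from_truncated_point_module (n : nat)
    (L : {ffun 'I_n.+1 -> proj_space K m}) : Prop :=
  exists (M : rmodType A) (Mg : nat -> M -> Prop),
    is_truncated_point_module n Mg /\ truncation_recorded_by Mg L.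

End PointVarieties.

Section Zariski.
Context (F : fieldType) (m n : nat).

(* A point of (P^(m-1))^(n+1) with coordinates in some extension K of F.       *)
Record mpoint : Type := MPoint {
  mp_field : fieldType;
  mp_emb : {rmorphism F -> mp_field};
  mp_coords : {ffun 'I_n.+1 -> proj_space mp_field m} }.

(* Polynomials over F in the n.+1 * m homogeneous coordinates on              *)
(* (P^(m-1))^(n+1), spelled out because monalg redefines the notation {mpoly}. *)
Notation multi_poly := (mpoly.mpoly (n.+1 * m) F).

(* The variable of index mxvec_index i j is the j-th homogeneous coordinate on *)
(* the i-th factor.                                                            *)
Definition multihomogeneous (p : multi_poly) : Prop :=
  exists d : 'I_n.+1 -> nat, forall u, u \in mpoly.msupp p ->
    forall i, (\sum_(j < m) u (mxvec_index i j))%N = d i.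

Definition vanishes_at (p : multi_poly) (x : mpoint) : Prop :=
  forall lambda : 'M[mp_field x]_(n.+1, m),
    (forall i, hom_coords (row i lambda) (mp_coords x i)) ->
    (map_mpoly (mp_emb x) p).@[mxvec lambda 0] = 0.

Definition zariski_closed (Z : mpoint -> Prop) : Prop :=
  exists I : multi_poly -> Prop,
    (forall p, I p -> multihomogeneous p) /\
    forall x, Z x <-> forall p, I p -> vanishes_at p x.

Definition included (S T : mpoint -> Prop) : Prop := forall x, S x -> T x.

Definition irreducible_set (S : mpoint -> Prop) : Prop :=
  (exists x, S x) /\
  forall Z1 Z2, zariski_closed Z1 -> zariski_closed Z2 ->
    (forall x, S x -> Z1 x \/ Z2 x) -> included S Z1 \/ included S Z2.

Definition irreducible_component (X C : mpoint -> Prop) : Prop :=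
  [/\ irreducible_set C, included C X &
      forall S, irreducible_set S -> included S X -> included C S ->
        included S C].

(* X has exactly c irreducible components.                                     *)
Definition num_components (X : mpoint -> Prop) (c : nat) : Prop :=
  exists C : 'I_c -> mpoint -> Prop,
    [/\ forall k, irreducible_component X (C k),
        forall k l, (forall x, C k x <-> C l x) -> k = l &
        forall Z, irreducible_component X Z ->
          exists k, forall x, Z x <-> C k x].

(* Over an extension K of F the algebra is monomial_algebra K ws, which is     *)
(* the base change to K of monomial_algebra F ws.                              *)
Definition point_variety (ws : seq {fmonom 'I_m}) (x : mpoint) : Prop :=
  extends_to_point_module ws (mp_coords x).

Definition truncated_point_variety (ws : seq {fmonom 'I_m}) (x : mpoint) : Prop :=
  from_truncated_point_module ws (mp_coords x).

End Zariski.

(* The power series with coefficients a equals a quotient p / q, i.e.          *)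
(* q * (sum_n a_n t^n) = p as formal power series.                             *)
Definition rational_series (a : nat -> rat) : Prop :=
  exists p q : {poly rat}, q != 0 /\
    forall n, \sum_(k < n.+1) q`_k * a (n - k)%N = p`_n.

(* Main.v *)
(* Over every extension K of F, a finite or infinite sequence of lines        *)
(* lambda_0, lambda_1, ... comes from a (truncated) point module exactly      *)
(* when, for each relation w and each position i, the product of the          *)
(* coordinates of lambda_i, lambda_(i+1), ... selected by the letters of w    *)
(* vanishes; the module is then the one with basis e_i. This depends only on  *)
(* the word of supports T_i = {j | lambda_(i,j) <> 0}, so both varieties are  *)
(* finite unions of products of coordinate subspaces P^(T_0) x ... x P^(T_n). *)
(* Each product is irreducible, as it has a generic point with independent    *)
(* transcendental coordinates; hence the components correspond to the maximal *)
(* admissible words of length n.+1 over the alphabet of nonempty subsets of   *)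
(* {0, ..., m-1}. Avoiding the relations, being infinitely prolongable, and   *)
(* being maximal are all recognized by finite automata, and the number of     *)
(* accepted words of each length satisfies a linear recurrence.               *)
From HB Require Import structures.
Require Import Defs.
From mathcomp Require Import all_boot all_order all_algebra.
From mathcomp Require Import finmap.
From mathcomp Require Import boolp.
From mathcomp Require Import monalg.
From mathcomp Require Import mpoly.

Set Implicit Arguments.
Unset Strict Implicit.
Unset Printing Implicit Defensive.

Import GRing.Theory.
Local Open Scope ring_scope.

(** * Counting words of a recognizable language *)

(** A family of rows [lambda] defines a module exactly when every relation acts by zero on every
    basis vector, that is, when at each position the product of the coordinates selected by a
    relation vanishes. Only the supports of the rows matter, so membership in either variety is a
    condition on a word of nonempty subsets of ['I_m] ([truncated_point_varietyP],
    [point_varietyP]): it avoids the relations and, for point modules, has an infinite avoiding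
    continuation. Necessity comes from letting a relation act ([not_fits_relation]), sufficiency
    from an explicit module ([path_module]).

    Shrinking the letters to smaller nonempty sets preserves the condition, so each variety is a
    finite union of products of coordinate subspaces. Such a product has a generic point
    ([generic_point]), hence is irreducible, and the components are the products attached to maximal
    words ([num_components_strata]).

    Avoidance looks at a bounded window of letters, prolongability depends only on the state
    reached, and maximality is decided by a subset construction, so all these languages are
    recognizable. Words of given length are then counted by powers of a transition matrix
    ([rational_recognizable]), and Cayley-Hamilton yields the linear recurrence. *)

Definition recognizable (S : finType) (P : seq S -> Prop) : Prop :=
  exists (Q : finType) (q0 : Q) (d : Q -> S -> Q) (acc : pred Q),
    forall s, P s <-> acc (foldl d q0 s).

Definition forever (S : Type) (P : seq S -> Prop) (s : seq S) : Prop :=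
  exists c : nat -> S, forall n, P (s ++ mkseq c n).

(** The existence of a continuation depends on [s] only through the state it reaches, so the same
    automaton works with new accepting states, chosen classically. *)
Lemma recognizable_forever (S : finType) (P : seq S -> Prop) :
  recognizable P -> recognizable (forever P).
Proof.
case=> Q [q0 [d [acc accP]]].
exists Q, q0, d, (fun q =>
  `[< exists c : nat -> S, forall n, acc (foldl d q (mkseq c n)) >]) => s.
split=> [[c cP]|/asboolP[c cP]].
  by apply/asboolP; exists c => n; rewrite -foldl_cat; apply/accP.
by exists c => n; apply/accP; rewrite foldl_cat.
Qed.

Definition maximal_word (S : eqType) (r : rel S) (P : seq S -> Prop)
    (s : seq S) : Prop :=
  P s /\ forall s', all2 r s s' -> P s' -> s' = s.

Lemma all2_rcons (S U : Type) (r : S -> U -> bool) s c t c' :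
  all2 r (rcons s c) (rcons t c') = all2 r s t && r c c'.
Proof.
elim: s t => [|a s IHs] [|b t] /=; rewrite ?andbT ?andbF //.
- by case: t => [|? ?]; rewrite /= ?andbF.
- by case: s {IHs} => [|? ?]; rewrite /= ?andbF.
- by rewrite IHs andbA.
Qed.

Lemma all2_refl (S : Type) (r : rel S) s : reflexive r -> all2 r s s.
Proof. by move=> r_refl; elim: s => //= c s ->; rewrite r_refl. Qed.

(* Alongside the state reached by s, the automaton carries the set of states  *)
(* reached by the words strictly above s.                                     *)
Lemma recognizable_maximal (S : finType) (r : rel S) (P : seq S -> Prop) :
  reflexive r -> recognizable P -> recognizable (maximal_word r P).
Proof.
move=> r_refl [Q [q0 [d [acc accP]]]].
(* A word strictly above [rcons s c] either is already strictly above on [s], with any last letter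
   above [c], or equals [s] there and differs in the last letter. *)
pose d' (x : Q * {set Q}) (c : S) : Q * {set Q} :=
  (d x.1 c,
   [set q | [exists p in x.2, [exists c', r c c' && (q == d p c')]]
         || [exists c', [&& r c c', c' != c & q == d x.1 c']]]).
pose run s := foldl d' (q0, set0) s.
have run1 s : (run s).1 = foldl d q0 s.
  elim/last_ind: s => [//|s c IHs].
  by rewrite /run !foldl_rcons /= -/(run s) IHs.
have run2 s q : reflect
    (exists s', [/\ all2 r s s', s' <> s & foldl d q0 s' = q])
    (q \in (run s).2).
  elim/last_ind: s q => [|s c IHs] q.
    by rewrite inE; apply: ReflectF; case=> [[|? ?]] [].
  rewrite /run foldl_rcons -/(run s) inE.
  apply: (iffP orP) => [[|]|].
  - case/exists_inP=> p /IHs [t [st tNs tp]] /existsP [c' /andP [rc /eqP ->]].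
    exists (rcons t c'); rewrite all2_rcons st rc foldl_rcons tp; split => //.
    by move/rcons_inj; case.
  - case/existsP=> c' /and3P [rc /eqP cN /eqP ->].
    exists (rcons s c'); rewrite all2_rcons all2_refl // rc foldl_rcons run1.
    by split => //; move/rcons_inj; case.
  case=> t []; case/lastP: t => [|t c']; first by case: s {IHs} => [|? ?].
  rewrite all2_rcons foldl_rcons => /andP [st rc] tN <-.
  case: (eqVneq t s) tN st => [-> tN _|/eqP tN _ st].
    right; apply/existsP; exists c'; rewrite rc run1 eqxx andbT /=.
    by apply/eqP => e; apply: tN; rewrite e.
  left; apply/exists_inP; exists (foldl d q0 t); first by apply/IHs; exists t.
  by apply/existsP; exists c'; rewrite rc eqxx.
exists _, (q0, set0), d', 
  (fun x : Q * {set Q} => acc x.1 && ~~ [exists q in x.2, acc q]) => s.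
rewrite -/(run s) run1; split.
  case=> /accP -> /= smax; apply/negP => /exists_inP [q /run2 [t [st tN <-]]].
  by move/accP => /(smax _ st).
case/andP=> /accP Ps /negP sN; split=> // t st /accP at_.
apply: contrapT => tN; apply: sN; apply/exists_inP.
by exists (foldl d q0 t) => //; apply/run2; exists t.
Qed.

(* Cayley-Hamilton turns the characteristic polynomial into a recurrence.     *)
Lemma rational_matrix_series (N : nat) (A : 'M[rat]_N.+1)
    (u : 'rV[rat]_N.+1) (v : 'cV[rat]_N.+1) :
  rational_series (fun n => (u *m A ^+ n *m v) 0 0).
Proof.
set a := fun n => _; pose c := char_poly A.
have szc : size c = N.+2 by rewrite size_char_poly.
(* The reversed characteristic polynomial; its constant term is the leading coefficient of [c],
   namely 1, so it is nonzero. *)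
pose q := \poly_(k < N.+2) c`_(N.+1 - k).
have rec n : (N.+1 <= n)%N -> \sum_(k < n.+1) q`_k * a (n - k)%N = 0.
  move=> leNn.
  have -> : \sum_(k < n.+1) q`_k * a (n - k)%N
          = \sum_(k < N.+2) q`_k * a (n - k)%N.
    rewrite [RHS](big_ord_widen _ (fun k => q`_k * a (n - k)%N)
      (leNn : N.+2 <= n.+1)%N).
    rewrite [LHS](bigID (fun i : 'I_n.+1 => (i < N.+2)%N)) /=.
    rewrite [X in _ + X]big1 ?addr0 //.
    by move=> i iN; rewrite coef_poly (negPf iN) mul0r.
  rewrite (reindex_inj rev_ord_inj) /=.
  have -> : \sum_(j < N.+2) q`_(N.+2 - j.+1) * a (n - (N.+2 - j.+1))%N
       = (u *m (A ^+ (n - N.+1) * \sum_(j < N.+2) c`_j *: A ^+ j) *m v) 0 0.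
    rewrite mulr_sumr mulmx_sumr mulmx_suml summxE; apply: eq_bigr => j _.
    have jN : (j <= N.+1)%N by rewrite -ltnS.
    rewrite coef_poly subSS ltnS leq_subr subKn //.
    rewrite -scalerAr -exprD -scalemxAr -scalemxAl mxE /a.
    by rewrite subnBA // addnC addnBAC // addnC.
  have := Cayley_Hamilton A; rewrite /horner_mx /horner_morph.
  rewrite horner_coef size_map_poly szc => CH.
  under eq_bigr do rewrite -mul_scalar_mx -coef_map.
  by rewrite CH mulr0 mulmx0 mul0mx mxE.
exists (\poly_(n < N.+1) \sum_(k < n.+1) q`_k * a (n - k)%N), q; split.
  apply/eqP => /(congr1 (coefp 0)) /=; rewrite coef0 coef_poly /= subn0 => c0.
  have := monicP (char_poly_monic A); rewrite /lead_coef szc /= c0.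
  by move/eqP; rewrite eq_sym oner_eq0.
move=> n; rewrite coef_poly; case: ltnP => // /rec; exact.
Qed.

Lemma rational_series_ext (a b : nat -> rat) :
  a =1 b -> rational_series a -> rational_series b.
Proof.
move=> ab [p [q [qN0 pq]]]; exists p, q; split=> // n; rewrite -pq.
by apply: eq_bigr => k _; rewrite ab.
Qed.

Lemma sum_tuple_cons (S : finType) (V : zmodType) n (f : n.+1.-tuple S -> V) :
  \sum_t f t = \sum_c \sum_(t : n.-tuple S) f [tuple of c :: t].
Proof.
rewrite pair_big /=.
rewrite (reindex (fun x : S * n.-tuple S => [tuple of x.1 :: x.2])) //=.
exists (fun t => (thead t, [tuple of behead t])) => [[c t] _|t _] /=.
  by congr pair; apply: val_inj.
by rewrite [RHS]tuple_eta.
Qed.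

(** Transfer matrix: [A] counts the letters leading from one state to another, so the entries of
    [A ^+ n *m v] count the accepted words of length [n] from each state. *)
Lemma rational_recognizable (S : finType) (P : seq S -> Prop) :
  recognizable P ->
  rational_series (fun n => #|[set t : n.+1.-tuple S | `[< P t >]]|%:R).
Proof.
case=> Q [q0 [d [acc accP]]].
have [N cardQ] : exists N, #|Q| = N.+1.
  by exists #|Q|.-1; rewrite prednK //; apply/card_gt0P; exists q0.
pose e (i : 'I_N.+1) : Q := enum_val (cast_ord (esym cardQ) i).
pose r (q : Q) : 'I_N.+1 := cast_ord cardQ (enum_rank q).
have rK : cancel r e by move=> q; rewrite /e /r cast_ordK enum_rankK.
pose A : 'M[rat]_N.+1 := \matrix_(i, j) #|[set c | r (d (e i) c) == j]|%:R.
pose v : 'cV[rat]_N.+1 := \col_i (acc (e i))%:R.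
have AE n q : \sum_(t : n.-tuple S) ((acc (foldl d q t))%:R : rat)
            = (A ^+ n *m v) (r q) 0.
  elim: n q => [|n IHn] q.
    rewrite expr0 mul1mx mxE rK (big_pred1 [tuple]) //.
    by move=> t; apply/esym/eqP; exact: tuple0.
  rewrite sum_tuple_cons exprS -mulmxA mxE.
  under eq_bigr do rewrite /= IHn.
  rewrite (partition_big (fun c => r (d q c)) xpredT) //=.
  apply: eq_bigr => j _; rewrite mxE rK.
  rewrite -sum1dep_card natr_sum mulr_suml.
  by apply: eq_bigr => c /eqP ->; rewrite mul1r.
(* The words have length [n.+1]; the extra factor [A] is absorbed into the row vector. *)
pose u : 'rV[rat]_N.+1 := delta_mx 0 (r q0) *m A.
apply: rational_series_ext (rational_matrix_series A u v) => n.
rewrite /u -[X in X *m v]mulmxA (_ : A *m A ^+ n = A ^+ n.+1) ?exprS //.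
rewrite -mulmxA -rowE mxE -exprS -AE.
rewrite -sum1dep_card natr_sum [RHS]big_mkcond /=; apply: eq_bigr => t _.
rewrite (_ : `[< P t >] = acc (foldl d q0 t)); first by case: ifP.
by apply/asboolP/idP => /accP.
Qed.

(** * Words of sets avoiding the relations *)

Lemma all2_rev (S U : Type) (r : S -> U -> bool) s t :
  all2 r (rev s) (rev t) = all2 r s t.
Proof.
elim: s t => [|a s IHs] [|b t] //=.
- by rewrite rev_cons; case: (rev t).
- by rewrite rev_cons; case: (rev s).
by rewrite !rev_cons all2_rcons IHs andbC.
Qed.

Section Avoiding.
Variable m : nat.
Implicit Types (T : nat -> {set 'I_m}) (w : seq 'I_m) (s : seq {set 'I_m}).

(** When [T] lists the supports of rows of coordinates, this says that the product of the
    coordinates selected by [w] from position [i] on is nonzero. *)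
Fixpoint fits T (i : nat) w : bool :=
  if w is a :: w' then (a \in T i) && fits T i.+1 w' else true.

Lemma fits_sub T T' i w :
  (forall k, T k \subset T' k) -> fits T i w -> fits T' i w.
Proof.
move=> TT'; elim: w i => //= a w IHw i /andP [ai /IHw ->].
by rewrite (subsetP (TT' i)).
Qed.

Lemma fits_eq T T' i w :
  (forall k, k < i + size w -> T k = T' k)%N -> fits T i w = fits T' i w.
Proof.
elim: w i => //= a w IHw i TT'; rewrite TT' ?addnS ?ltnS ?leq_addr //.
by rewrite IHw // => k; rewrite addSnnS => /TT'.
Qed.

Lemma fits_rcons T i w a :
  fits T i (rcons w a) = fits T i w && (a \in T (i + size w)%N).
Proof.
elim: w i => [|b w IHw] i /=; first by rewrite addn0 andbT.
by rewrite IHw andbA addSnnS.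
Qed.

Lemma fits_bound s i w :
  w != [::] -> fits (nth set0 s) i w -> (i + size w <= size s)%N.
Proof.
case/lastP: w => // w a _; rewrite fits_rcons size_rcons => /andP [_].
case: (ltnP (i + size w) (size s)) => [|le]; first by rewrite addnS.
by rewrite nth_default // inE.
Qed.

(* Finite words of sets are read as infinite ones by appending empty sets, in *)
(* which no nonempty word fits.                                               *)
Definition avoids (ws : seq {fmonom 'I_m}) T : Prop :=
  forall w : {fmonom 'I_m}, w \in ws -> forall i, ~~ fits T i w.

Lemma avoids_sub ws T T' :
  (forall k, T k \subset T' k) -> avoids ws T' -> avoids ws T.
Proof. by move=> TT' av w /av nf i; apply: contra (nf i); exact: fits_sub. Qed.

Definition safe_word ws s : Prop :=
  all (fun c => c != set0) s /\ avoids ws (nth set0 s).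

(* r is the reversed word read so far, whose first letters alone decide       *)
(* whether some w fits at its end.                                            *)
Definition hits (ws : seq {fmonom 'I_m}) (r : seq {set 'I_m}) : bool :=
  has (fun w : {fmonom 'I_m} => (size w <= size r)%N &&
         all2 (fun (a : 'I_m) (c : {set 'I_m}) => a \in c)
           (rev w) (take (size w) r)) ws.

Lemma fits_all2 s w : size w = size s ->
  fits (nth set0 s) 0 w = all2 (fun (a : 'I_m) (c : {set 'I_m}) => a \in c) w s.
Proof.
elim/last_ind: s w => [|s c IHs] w; case/lastP: w => [|w a] //.
- by rewrite size_rcons.
- by rewrite size_rcons.
rewrite !size_rcons => -[sw]; rewrite fits_rcons all2_rcons -IHs // add0n sw.
rewrite nth_rcons ltnn eqxx; congr andb; apply: fits_eq => k.
by rewrite add0n sw nth_rcons => ->.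
Qed.

Lemma fits_drop s i w :
  fits (nth set0 s) i w = fits (nth set0 (drop i s)) 0 w.
Proof.
have gen j : fits (nth set0 s) (i + j) w = fits (nth set0 (drop i s)) j w.
  elim: w j => //= a w IHw j.
  by rewrite -addnS IHw nth_drop.
by rewrite -gen addn0.
Qed.

Lemma hitsP ws s : reflect
  (exists2 w : {fmonom 'I_m}, w \in ws &
     (size w <= size s)%N /\ fits (nth set0 s) (size s - size w) w)
  (hits ws (rev s)).
Proof.
have eqv (w : {fmonom 'I_m}) : (size w <= size s)%N ->
    fits (nth set0 s) (size s - size w) w
    = all2 (fun (a : 'I_m) (c : {set 'I_m}) => a \in c)
        (rev w) (take (size w) (rev s)).
  move=> le; rewrite fits_drop fits_all2; last by rewrite size_drop subKn.
  by rewrite take_rev all2_rev.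
apply: (iffP hasP) => -[w wws]; rewrite ?size_rev.
  by case/andP=> le; rewrite -eqv //; exists w.
by case=> le; rewrite eqv // => h; exists w; rewrite ?size_rev ?le.
Qed.

(** Only an empty relation can fit in the empty word; then the algebra is zero and the automaton
    must reject from the start. *)
Lemma safe_nil ws : safe_word ws [::] <-> ~~ hits ws [::].
Proof.
split=> [[_ av]|nh].
  apply/negP => /(hitsP ws [::]) [w wws [_ fw]].
  by move: (av w wws (0 - size w)%N); rewrite fw.
split=> // w wws i; apply/negP; have [w0 _|wN0] := eqVneq (w : seq 'I_m) [::].
  move/negP: nh; apply; apply/(hitsP ws [::]); exists w => //.
  by rewrite w0.
move/(fits_bound wN0); rewrite leqn0 addn_eq0 size_eq0 (negPf wN0) andbF //.
Qed.

(** A nonempty relation that fits in the longer word but not in [s] must end exactly at the new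
    letter. *)
Lemma safe_rcons ws s c :
  safe_word ws (rcons s c)
  <-> safe_word ws s /\ (c != set0) && ~~ hits ws (rev (rcons s c)).
Proof.
have pre k : nth set0 s k \subset nth set0 (rcons s c) k.
  rewrite nth_rcons; case: ltnP => // le.
  by rewrite nth_default // sub0set.
rewrite /safe_word all_rcons; split.
  case=> /andP [-> ->] av; split; first by split=> //; apply: avoids_sub av.
  apply/negP => /hitsP [w wws [_ fw]].
  by move/negP: (av w wws (size (rcons s c) - size w)%N); apply.
case=> -[-> av] /andP [-> nh]; split=> // w wws i.
apply/negP => fw; move/negP: nh; apply.
have nfw : ~~ fits (nth set0 s) i w by exact: av.
have [w0|wN0] := eqVneq (w : seq 'I_m) [::]; first by rewrite w0 in nfw.
have le := fits_bound wN0 fw.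
apply/hitsP; exists w => //; split.
  by apply: leq_trans le; rewrite leq_addl.
suff <- : (i + size w)%N = size (rcons s c) by rewrite addnK.
apply/eqP; rewrite eqn_leq le leqNgt size_rcons ltnS; apply/negP => lt.
move/negP: nfw; apply.
rewrite -(fits_eq (T := nth set0 (rcons s c))) // => k kl.
by rewrite nth_rcons (leq_trans kl lt).
Qed.

Lemma hits_take ws D r :
  {in ws, forall w : {fmonom 'I_m}, size w <= D}%N ->
  hits ws (take D r) = hits ws r.
Proof.
move=> wD; apply: eq_in_has => w /wD le.
rewrite take_takel // size_take_min leq_min.
by rewrite le.
Qed.

(* Only as many of the last letters as the longest relation has need be kept. *)
Lemma recognizable_safe ws : recognizable (safe_word ws).
Proof.
pose D := \max_(w <- ws) size (w : seq 'I_m).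
have wD : {in ws, forall w : {fmonom 'I_m}, size w <= D}%N.
  by move=> w wws; rewrite /D (big_rem w wws) leq_maxl.
pose mk (s : seq {set 'I_m}) : D.-bseq {set 'I_m} := insub_bseq D (take D s).
have mkE s : mk s = take D s :> seq _.
  by rewrite insubdK // -topredE /= size_take_min geq_minl.
(* A state holds the last [D] letters, newest first, and whether the word read so far is safe. *)
pose d (x : D.-bseq {set 'I_m} * bool) c :=
  (mk (c :: x.1), x.2 && ((c != set0) && ~~ hits ws (mk (c :: x.1)))).
pose q0 : D.-bseq {set 'I_m} * bool := (mk [::], ~~ hits ws [::]).
exists _, q0, d, snd => s.
suff [] : (foldl d q0 s).1 = take D (rev s) :> seq _ /\
          (safe_word ws s <-> (foldl d q0 s).2) by [].
elim/last_ind: s => [|s c [IH1 IH2]].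
  by split; [rewrite /= mkE|exact: safe_nil].
have take_cons r : take D (c :: take D r) = take D (c :: r).
  by case: (D) => //= k; rewrite take_takel.
have st : (foldl d q0 (rcons s c)).1 = take D (rev (rcons s c)) :> seq _.
  by rewrite foldl_rcons /= mkE IH1 rev_rcons take_cons.
split=> //; apply: (iff_trans (safe_rcons ws s c)).
rewrite foldl_rcons /= mkE IH1 take_cons -rev_rcons hits_take //.
split; first by case=> /IH2 -> ->.
by case/andP=> /IH2 ? ?.
Qed.

(** A violation involves finitely many letters, so an infinite word avoids the relations as soon as
    all its finite prefixes do. *)
Lemma forever_safeP ws s : forever (safe_word ws) s <->
  exists T, [/\ forall k, T k != set0, avoids ws T &
                forall k, (k < size s)%N -> nth set0 s k = T k].
Proof.
split=> [[c cP]|[T [TN0 av sT]]].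
  pose T k := nth set0 (s ++ mkseq c k.+1) k.
  have TE N k : (k < size s + N)%N -> nth set0 (s ++ mkseq c N) k = T k.
    move=> lt; rewrite /T !nth_cat; case: ltnP => // le.
    by rewrite [LHS]nth_mkseq ?ltn_subLR // nth_mkseq // ltnS leq_subr.
  exists T; split=> [k|w wws i|k ks].
  - have kN : (k < size (s ++ mkseq c k.+1))%N.
      by rewrite size_cat size_mkseq addnS ltnS leq_addl.
    by have [/(all_nthP set0) /(_ k kN)] := cP k.+1.
  - have [_ /(_ w wws i)] := cP (i + size w)%N; apply: contra.
    rewrite (@fits_eq T (nth set0 (s ++ mkseq c (i + size w)))) // => k kw.
    by rewrite TE // (leq_trans kw) // leq_addl.
  by rewrite /T nth_cat ks.
exists (fun k => T (size s + k)%N) => N.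
have sT' k : (k < size s + N)%N ->
    nth set0 (s ++ mkseq (fun k => T (size s + k)%N) N) k = T k.
  move=> lt; rewrite nth_cat; case: ltnP => [/sT ->//|le].
  by rewrite nth_mkseq ?subnKC // ltn_subLR.
split.
  apply/(all_nthP set0) => k; rewrite size_cat size_mkseq => kN.
  by rewrite sT'.
apply: avoids_sub av => k; case: (ltnP k (size s + N)) => [/sT' ->//|le].
by rewrite nth_default ?sub0set // size_cat size_mkseq.
Qed.

End Avoiding.

(** * Irreducible components of a union of strata *)

Lemma rmorph_mmap (k : nat) (R S S' : comNzRingType)
    (g : {rmorphism S -> S'}) (f : R -> S) (h : 'I_k -> S)
    (p : mpoly.mpoly k R) :
  g (mmap f h p) = mmap (g \o f)%FUN (g \o h)%FUN p.
Proof.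
rewrite /mmap rmorph_sum; apply: eq_bigr => u _; rewrite rmorphM /=.
congr (_ * _); rewrite /mmap1 rmorph_prod.
by apply: eq_bigr => i _; rewrite rmorphXn.
Qed.

Lemma meval_map_mpoly (k : nat) (R S : comNzRingType)
    (f : {rmorphism R -> S}) (p : mpoly.mpoly k R) (v : 'I_k -> S) :
  (map_mpoly f p).@[v] = mmap f v p.
Proof.
rewrite /map_mpoly (rmorph_mmap (meval v)) /mmap; apply: eq_bigr => u _ /=.
rewrite mevalC; congr (_ * _); apply: mmap1_eq => i /=.
by rewrite mevalXU.
Qed.

Lemma eq_mmap (k : nat) (R S : comNzRingType)
    (f f' : R -> S) (h h' : 'I_k -> S) (p : mpoly.mpoly k R) :
  f =1 f' -> h =1 h' -> mmap f h p = mmap f' h' p.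
Proof.
move=> ff' hh'; apply: eq_bigr => u _; rewrite ff'; congr (_ * _).
exact: mmap1_eq.
Qed.

(** * Supports of points of projective space *)

Section Support.
Context (K : fieldType) (m : nat).
Implicit Types (L : proj_space K m) (v : 'rV[K]_m).

Definition row_support v : {set 'I_m} := [set j | v 0 j != 0].

Definition proj_support L : {set 'I_m} := row_support (vpick (val L)).

Lemma row_support_neq0 v : (row_support v != set0) = (v != 0).
Proof.
apply/set0Pn/idP => [[j]|].
  by rewrite inE; apply: contraNneq => ->; rewrite mxE.
apply: contra_neqP => nj; apply/rowP => j; rewrite mxE.
by apply: contra_notP nj => /eqP vj; exists j; rewrite inE.
Qed.

Lemma hom_coords_neq0 v L : hom_coords v L -> v != 0.
Proof.
move=> vL; have := valP L; rewrite -vL dim_vline.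
by case: (v != 0).
Qed.

Lemma hom_coords_vpick L : hom_coords (vpick (val L)) L.
Proof.
have pN0 : vpick (val L) != 0.
  by rewrite vpick0 -dimv_eq0 (eqP (valP L)).
apply/eqP; rewrite eqEdim dim_vline pN0 (eqP (valP L)) leqnn andbT.
by rewrite -memvE memv_pick.
Qed.

(** Two representatives of a line differ by a nonzero scalar, so the vector chosen by [vpick] does
    not matter. *)
Lemma hom_coords_support v L : hom_coords v L -> row_support v = proj_support L.
Proof.
move=> vL; have pL := hom_coords_vpick L.
have : vpick (val L) \in <[v]>%VS by rewrite vL memv_pick.
case/vlineP => c pE; apply/setP => j; rewrite !inE pE mxE mulf_eq0.
suff -> : (c == 0) = false by [].
by apply: contraNF (hom_coords_neq0 pL); rewrite pE => /eqP ->; rewrite scale0r.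
Qed.

Lemma proj_support_neq0 L : proj_support L != set0.
Proof. by rewrite row_support_neq0 (hom_coords_neq0 (hom_coords_vpick L)). Qed.

Lemma proj_of_row v : v != 0 -> exists L, hom_coords v L.
Proof.
move=> vN0; have dv : \dim <[v]>%VS == 1%N by rewrite dim_vline vN0.
by exists (exist _ <[v]>%VS dv).
Qed.

End Support.

(** * Coordinate strata and their generic points *)

Section Components.
Context (F : fieldType) (m n : nat).
Local Notation point := (@mpoint F m n).
Local Notation N := (n.+1 * m)%N.
Local Notation word := (n.+1.-tuple {set 'I_m}).
Implicit Types (x : point) (t : word).

Definition supports x : word := [tuple proj_support (mp_coords x i) | i < n.+1].

Definition below : rel (seq {set 'I_m}) :=
  all2 (fun a b : {set 'I_m} => a \subset b).

(** The closed product of the coordinate subspaces given by the letters of [t]: supports need only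
    be contained in them. *)
Definition stratum t x : Prop := below (supports x) t.

Lemma below_tupleP t t' :
  reflect (forall i, tnth t i \subset tnth t' i) (below t t').
Proof.
rewrite /below all2E !size_tuple eqxx /=.
apply: (iffP (all_nthP (set0, set0))) => [tt' i|tt' i].
  have := tt' i; rewrite size_zip !size_tuple minnn => /(_ (ltn_ord i)).
  by rewrite nth_zip ?size_tuple //= -!tnth_nth.
rewrite size_zip !size_tuple minnn => iN.
rewrite nth_zip ?size_tuple //=.
by have := tt' (Ordinal iN); rewrite !(tnth_nth set0).
Qed.

Lemma below_refl t : below t t.
Proof. exact/below_tupleP. Qed.

Lemma below_trans t1 t2 t3 : below t1 t2 -> below t2 t3 -> below t1 t3.
Proof.
move=> /below_tupleP h1 /below_tupleP h2; apply/below_tupleP => i.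
exact: subset_trans (h1 i) (h2 i).
Qed.

Lemma below_anti t1 t2 : below t1 t2 -> below t2 t1 -> t1 = t2.
Proof.
move=> /below_tupleP h1 /below_tupleP h2; apply: eq_from_tnth => i.
by apply/eqP; rewrite eqEsubset h1 h2.
Qed.

Lemma coords_support x (c : 'M[mp_field x]_(n.+1, m)) i j :
  (forall i, hom_coords (row i c) (mp_coords x i)) ->
  (j \in tnth (supports x) i) = (c i j != 0).
Proof.
move=> /(_ i) /hom_coords_support; rewrite tnth_mktuple => <-.
by rewrite inE mxE.
Qed.

Lemma point_of_matrix (K : fieldType) (f : {rmorphism F -> K})
    (c : 'M[K]_(n.+1, m)) : (forall i, row i c != 0) ->
  exists L : {ffun 'I_n.+1 -> proj_space K m},
    forall i, hom_coords (row i c) (mp_coords (MPoint f L) i).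
Proof.
move=> cN0; have /choice [L LP] := fun i => proj_of_row (cN0 i).
by exists [ffun i => L i] => i; rewrite /= ffunE.
Qed.

Lemma exists_coords x : exists c : 'M[mp_field x]_(n.+1, m),
  forall i, hom_coords (row i c) (mp_coords x i).
Proof.
exists (\matrix_i vpick (val (mp_coords x i))) => i.
by rewrite rowK; exact: hom_coords_vpick.
Qed.

Definition nonempty_word (t : seq {set 'I_m}) := all (fun c => c != set0) t.

Lemma nonempty_supports x : nonempty_word (supports x).
Proof.
by apply/(all_tnthP) => i; rewrite tnth_mktuple proj_support_neq0.
Qed.

Definition mask (K : pzRingType) t (c : 'M[K]_(n.+1, m)) : 'M[K]_(n.+1, m) :=
  \matrix_(i, j) (if j \in tnth t i then c i j else 0).

Lemma exists_stratum_point t (K : fieldType) (f : {rmorphism F -> K})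
    (c : 'M[K]_(n.+1, m)) :
  nonempty_word t -> (forall i j, c i j != 0) ->
  exists L : {ffun 'I_n.+1 -> proj_space K m},
    supports (MPoint f L) = t /\
    forall i, hom_coords (row i (mask t c)) (mp_coords (MPoint f L) i).
Proof.
move=> /(all_tnthP) tN0 cN0.
have [|L LP] := @point_of_matrix K f (mask t c).
  move=> i; have /set0Pn [j jt] := tN0 i.
  by apply/eqP => /rowP /(_ j) /eqP; rewrite !mxE jt (negPf (cN0 i j)).
exists L; split=> //; apply: eq_from_tnth => i; apply/setP => j.
rewrite (@coords_support (MPoint f L) _ i j LP) mxE.
case: ifP => // _; rewrite ?eqxx //.
by rewrite cN0.
Qed.

(** The equations are the monomials that involve, for every [t] in [TT], a variable off [t]. A point
    outside the union is detected by the product of its own nonzero coordinates, whose exponents are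
    [u0]. *)
Lemma zariski_closed_strata (TT : pred word) :
  zariski_closed (fun x => exists2 t, TT t & stratum t x).
Proof.
pose u0 x : 'X_{1..N} :=
  [multinom mxvec (\matrix_(i, j) (j \in tnth (supports x) i : nat)) 0%R k
  | k < N].
pose I (p : mpoly.mpoly N F) := exists2 u : 'X_{1..N}, p = mpolyX F u &
  forall t, TT t -> exists i j, j \notin tnth t i /\ u (mxvec_index i j) != 0%N.
exists I; split=> [p [u -> _]|x].
  exists (fun i => \sum_(j < m) u (mxvec_index i j))%N => v.
  by rewrite msuppX inE => /eqP ->.
split=> [[t Tt xt] p [u -> /(_ t Tt) [i [j [jt uj]]]] c cx|vx].
  have c0 : c i j = 0.
    apply/eqP; apply: contraNT jt => cij.
    by apply: (subsetP (below_tupleP _ _ xt i)); rewrite (coords_support _ _ cx).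
  rewrite map_mpolyX mevalX (bigD1 (mxvec_index i j)) //= mxvecE c0.
  by rewrite expr0n (negPf uj) mul0r.
apply: contrapT => nx; have [c cx] := exists_coords x.
have u0E i j : u0 x (mxvec_index i j) = (j \in tnth (supports x) i).
  by rewrite mnmE mxvecE mxE.
suff /vx /(_ c cx) /eqP : I (mpolyX F (u0 x)).
  rewrite map_mpolyX mevalX => /prodf_eq0 [k _].
  case/mxvec_indexP: k => i j; rewrite mxvecE u0E (coords_support _ _ cx).
  have [_|/negPf cN0] := eqVneq (c i j) 0; last by rewrite cN0.
  by rewrite expr0 oner_eq0.
exists (u0 x) => // t Tt.
have nxt : ~ forall i, tnth (supports x) i \subset tnth t i.
  by move=> /below_tupleP xt; apply: nx; exists t.
have [i /subsetPn [j jx jt]] :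
    exists i, ~~ (tnth (supports x) i \subset tnth t i).
  by apply: contra_notP nxt => ni i; apply: contra_notT ni => ?; exists i.
by exists i, j; rewrite u0E jx.
Qed.

Lemma zariski_closed_stratum t : zariski_closed (stratum t).
Proof.
have [I [Ihom IP]] := zariski_closed_strata (pred1 t).
exists I; split=> // x; rewrite -IP; split=> [xt|[t' /eqP -> //]].
by exists t => /=.
Qed.

Lemma irreducible_in_stratum (S : point -> Prop) (TT : seq word) :
  irreducible_set S -> (forall x, S x -> exists2 t, t \in TT & stratum t x) ->
  exists2 t, t \in TT & included S (stratum t).
Proof.
move=> [[x Sx] irr]; elim: TT => [|t TT IHT] ST; first by have [] := ST x Sx.
have := irr _ _ (zariski_closed_stratum t)
  (@zariski_closed_strata (fun t => t \in TT)).
case=> [y /ST [t' ]||].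
- by rewrite inE => /orP [/eqP ->|t'T] yt'; [left|right; exists t'].
- by exists t; rewrite // mem_head.
by move=> /IHT [t' t'T St']; exists t'; rewrite // inE t'T orbT.
Qed.

(* The coordinates on the stratum are independent indeterminates at this      *)
(* point, so a polynomial vanishing there vanishes on the whole stratum.      *)
Lemma generic_point t : nonempty_word t ->
  exists2 g : point, supports g = t &
    forall Z, zariski_closed Z -> Z g -> included (stratum t) Z.
Proof.
move=> tN0; pose P : idomainType := mpoly.mpoly N F.
pose X : 'M[P]_(n.+1, m) := \matrix_(i, j) mpolyX F U_(mxvec_index i j).
pose f : {rmorphism F -> {fraction P}} := (@tofrac P \o @mpolyC N F)%FUN.
have [|L [Lt Lc]] := @exists_stratum_point t _ f (map_mx (@tofrac P) X) tN0.
  by move=> i j; rewrite !mxE tofrac_eq0 -msupp_eq0 msuppX.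
exists (MPoint f L) => // Z [I [_ ZI]] /ZI gZ x xt; apply/ZI => p Ip c cx.
pose h k : P := mxvec (mask t X) 0 k.
(* Specializing the indeterminates to [c] turns the masked matrix into [c], since the coordinates of
   [x] off [t] already vanish. *)
have cE k : mmap (mp_emb x) (mxvec c 0) (h k) = mxvec c 0 k.
  case/mxvec_indexP: k => i j; rewrite /h !mxvecE !mxE.
  case: ifP => [_|/negbT jt]; first by rewrite mmapX mmap1U mxvecE.
  rewrite raddf0; apply/esym/eqP; apply: contraNT jt => cij.
  by apply: (subsetP (below_tupleP _ _ xt i)); rewrite (coords_support _ _ cx).
have hE k : mxvec (mask t (map_mx (@tofrac P) X)) 0 k = tofrac (h k).
  case/mxvec_indexP: k => i j; rewrite /h !mxvecE !mxE.
  by case: ifP => // _; rewrite raddf0.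
(* The polynomial ring embeds in its fraction field, so vanishing at the generic point is a
   polynomial identity. *)
have q0 : mmap (@mpolyC N F) h p = 0.
  apply/eqP; rewrite -(@tofrac_eq0 P) (rmorph_mmap (@tofrac P)).
  have := gZ p Ip _ Lc; rewrite /= meval_map_mpoly => <-.
  by apply/eqP; apply: eq_mmap => // k; rewrite hE.
have <- : mmap (mp_emb x) (mxvec c 0) (mmap (@mpolyC N F) h p)
        = (map_mpoly (mp_emb x) p).@[mxvec c 0].
  rewrite (rmorph_mmap (mmap (mp_emb x) (mxvec c 0))) meval_map_mpoly.
  by apply: eq_mmap => // a /=; rewrite mmapC.
by rewrite q0 raddf0.
Qed.

Lemma irreducible_stratum t : nonempty_word t -> irreducible_set (stratum t).
Proof.
move=> /generic_point [g gt gP].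
have tg : stratum t g by rewrite /stratum gt below_refl.
split; first by exists g.
move=> Z1 Z2 cZ1 cZ2 /(_ g tg) [Zg|Zg]; [left|right]; exact: gP.
Qed.

(** The generic point of the first stratum has support exactly [t]. *)
Lemma included_stratum t t' :
  nonempty_word t -> included (stratum t) (stratum t') -> below t t'.
Proof.
move=> /generic_point [g gt _] /(_ g); rewrite /stratum gt; apply.
exact: below_refl.
Qed.

Variables (X : point -> Prop) (P : seq {set 'I_m} -> Prop).
Hypothesis XP : forall x, X x <-> P (supports x).
Hypothesis P_nonempty : forall t : word, P t -> nonempty_word t.
Hypothesis P_below : forall t t' : word,
  nonempty_word t -> below t t' -> P t' -> P t.

Let maximal t : Prop := maximal_word (fun a b : {set 'I_m} => a \subset b) P t.

Lemma maximal_above t : P t -> exists2 t', maximal t' & below t t'.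
Proof.
move=> Pt; pose Q t' := `[< P t' >] && below t t'.
have Qt : Q t by rewrite /Q below_refl andbT; apply/asboolP.
(* The number of words below a word strictly increases with the word, so maximizing it gives a
   maximal word. *)
case: (@arg_maxnP _ t Q (fun t' => #|[set u : word | below u t']|) Qt).
move=> t' /andP [/asboolP Pt' tt'] t'max; exists t' => //.
split=> // s' t's' Ps'.
have ss' : size s' == n.+1.
  by move: t's'; rewrite all2E size_tuple eq_sym => /andP [].
rewrite -/(below _ _) in t's'; pose t1 : word := Tuple ss'.
have := t'max t1; rewrite /Q (below_trans (t2 := t') tt') // andbT.
move=> /(_ (asboolT Ps')) le; apply: contrapT => ne.
move: le; apply/negP; rewrite /geq -ltnNge; apply: proper_card.
apply/properP; split.
  by apply/subsetP => u; rewrite !inE => /below_trans; apply.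
exists t1; rewrite !inE ?below_refl //.
apply/negP => t1t'; apply: ne; rewrite -[s']/(val t1); congr val.
exact: below_anti.
Qed.

(** Each irreducible subset of [X] lies in a single maximal stratum; these strata are irreducible,
    and generic points show that none contains another. *)
Lemma num_components_strata :
  num_components X #|[set t : word | `[< maximal t >]]|.
Proof.
set M := [set t | _].
have MP (k : 'I_#|M|) : maximal (enum_val k).
  by have := enum_valP k; rewrite inE => /asboolP.
have max_below t t' : maximal t -> P t' -> below t t' -> t' = t.
  by case=> _ tmax Pt' tt'; apply: val_inj; apply: tmax.
have maxN0 t : maximal t -> nonempty_word t by case=> /P_nonempty.
have subX t : P t -> included (stratum t) X.
  move=> Pt x xt; apply/XP; apply: P_below xt Pt; exact: nonempty_supports.
have irrX S : irreducible_set S -> included S X ->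
    exists2 t, maximal t & included S (stratum t).
  move=> irrS SX; have [|t] := @irreducible_in_stratum S (enum M) irrS.
    move=> x /SX /XP /maximal_above [t tmax xt]; exists t => //.
    by rewrite mem_enum inE; apply/asboolP.
  by rewrite mem_enum inE => /asboolP; exists t.
have comp t : maximal t -> irreducible_component X (stratum t).
  move=> tmax; split; first by apply: irreducible_stratum; apply: maxN0.
    by apply: subX; case: tmax.
  move=> S irrS SX tS; have [t' t'max St'] := irrX S irrS SX.
  suff <- : t' = t by [].
  apply: max_below => //; first by case: t'max.
  by apply: included_stratum; [exact: maxN0|move=> x /tS /St'].
exists (fun k => stratum (enum_val k)); split=> [k|k l kl|Z [irrZ ZX Zmax]].
- exact: comp.
- apply: enum_val_inj; apply: below_anti; apply: included_stratum.
  + by apply: maxN0.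
  + by move=> x /kl.
  + by apply: maxN0.
  + by move=> x /kl.
have [t tmax Zt] := irrX Z irrZ ZX.
have tM : t \in M by rewrite inE; apply/asboolP.
exists (enum_rank_in tM t) => x; rewrite enum_rankK_in //.
split; first exact: Zt.
apply: Zmax => //; last by apply: subX; case: tmax.
by apply: irreducible_stratum; apply: maxN0.
Qed.

End Components.

(** * The module attached to a sequence of coordinates *)

Local Notation "v *> a" := (ract v a) (at level 40, left associativity).

(** * Action of monomials on a given module *)

Section MonomialAlgebra.
Context (K : fieldType) (m : nat) (ws : seq {fmonom 'I_m}).
Local Notation A := (monomial_algebra K ws).
Local Notation fa := (free_alg K m).

Definition word_mon (w : seq 'I_m) : A := mon_pi ws << FMonom w >>.

Lemma word_mon_nil : word_mon [::] = 1.
Proof. by rewrite /word_mon -fmoneE. Qed.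

Lemma word_mon_cat u w : word_mon (u ++ w) = word_mon u * word_mon w.
Proof.
rewrite /word_mon -[RHS]mon_piM malgM_def fgmulUU mulr1 /=.
by rewrite -[mmul _ _]/(fmmul _ _) fmmulE.
Qed.

Lemma word_mon1 a : word_mon [:: a] = mon_gen K ws a.
Proof. by rewrite /word_mon -fmuE. Qed.

Lemma mon_pi0 : mon_pi ws (0 : fa) = 0.
Proof. by apply: (@addrI _ (mon_pi ws 0)); rewrite -mon_piD !addr0. Qed.

Lemma word_mon_relation (w : {fmonom 'I_m}) : w \in ws -> word_mon w = 0.
Proof.
move=> wws; rewrite /word_mon fmK; apply/eqP.
rewrite -mon_pi0 mon_pi_eq subr0.
apply/monomial_idealP; exists [:: (1, w, 1)].
split; first by move=> t; rewrite inE => /eqP ->.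
by rewrite big_seq1 mul1r mulr1.
Qed.

Lemma mon_scal1 : mon_scal ws 1 = 1 :> A.
Proof. by rewrite /mon_scal scale1r. Qed.

Lemma mon_scalM c d : mon_scal ws (c * d) = mon_scal ws c * mon_scal ws d :> A.
Proof. by rewrite /mon_scal -[RHS]mon_piM mulr_algl scalerA. Qed.

Lemma malg_scalE c : c%:A = << c *g @mone {fmonom 'I_m} >> :> fa.
Proof. by rewrite -mul_malgC mulr1. Qed.

Lemma malg_algr c (f : fa) : f * c%:A = c *: f.
Proof.
apply/malgP => w; rewrite malg_scalE monalg.mcoeffZ.
rewrite [in LHS](monalgE f) mulr_suml raddf_sum /=.
rewrite [in RHS](monalgE f) raddf_sum /= mulr_sumr; apply: eq_bigr => u _.
by rewrite malgM_def fgmulUU mulm1 !monalg.mcoeffU mulrnAr mulrC.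
Qed.

Lemma mon_scalC c (a : A) : mon_scal ws c * a = a * mon_scal ws c.
Proof.
rewrite -[a]mon_piK /mon_scal -[LHS]mon_piM -[RHS]mon_piM.
by rewrite malg_algr mulr_algl.
Qed.

Section Ract.
Variable M : rmodType A.
Implicit Types (v : M) (a b : A).

Lemma ractM v a b : v *> (a * b) = v *> a *> b.
Proof. by rewrite /ract scalerA. Qed.

Lemma ract1 v : v *> 1 = v.
Proof. by rewrite /ract scale1r. Qed.

Lemma ract0 v : v *> 0 = 0.
Proof. by rewrite /ract scale0r. Qed.

Lemma ract_scal_inj v c : c != 0 -> v *> mon_scal ws c = 0 -> v = 0.
Proof.
move=> cN0 vc; rewrite -[v]ract1 -mon_scal1 -(mulfV cN0) mon_scalM ractM vc.
by rewrite /ract scaler0.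
Qed.

Variables (N : nat) (e : nat -> M) (T : nat -> {set 'I_m}).
Hypothesis e_neq0 : forall i, (i <= N)%N -> e i <> 0.
Hypothesis e_step : forall i j, (i < N)%N -> j \in T i ->
  exists2 c, c != 0 & e i *> mon_gen K ws j = e i.+1 *> mon_scal ws c.

Lemma ract_fits i w : (i + size w <= N)%N -> fits T i w ->
  exists2 c, c != 0 & e i *> word_mon w = e (i + size w)%N *> mon_scal ws c.
Proof.
elim: w i => [|a w IHw] i /=.
  by move=> _ _; exists 1; rewrite ?oner_eq0 // word_mon_nil mon_scal1 addn0.
rewrite -addSnnS => le /andP [ai fw].
have [c cN0 ec] := e_step (leq_trans (leq_addr _ _) le) ai.
have [d dN0 ed] := IHw _ le fw.
exists (d * c); first by rewrite mulf_neq0.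
rewrite -cat1s word_mon_cat ractM word_mon1 ec -ractM mon_scalC.
by rewrite ractM ed -ractM mon_scalM.
Qed.

(** A relation that fits would send [e i] to a nonzero multiple of a nonzero vector, yet it is zero
    in the algebra. The bound [N] is [n.+1] for truncated modules and [i + size w] for point
    modules. *)
Lemma not_fits_relation (w : {fmonom 'I_m}) i :
  w \in ws -> (i + size w <= N)%N -> ~~ fits T i w.
Proof.
move=> wws le; apply/negP => /(ract_fits le) [c cN0].
rewrite word_mon_relation // ract0 => /esym /(ract_scal_inj cN0).
exact: e_neq0.
Qed.

End Ract.
End MonomialAlgebra.

(** * The module with prescribed coordinates *)

Section PathModule.
Context (K : fieldType) (m : nat) (lam : nat -> 'rV[K]_m).
Local Notation fa := (free_alg K m).
Implicit Types (w : seq 'I_m) (v : {poly K}) (f g : fa).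

Fixpoint weight (i : nat) w : K :=
  if w is a :: w' then lam i 0 a * weight i.+1 w' else 1.

Lemma weight_cat i u w : weight i (u ++ w) = weight i u * weight (i + size u) w.
Proof.
elim: u i => [|a u IHu] i /=; first by rewrite mul1r addn0.
by rewrite IHu mulrA addSnnS.
Qed.

Lemma weight_eq0 i w :
  (weight i w == 0) = ~~ fits (fun k => row_support (lam k)) i w.
Proof.
elim: w i => [|a w IHw] i /=; first by rewrite oner_eq0.
by rewrite mulf_eq0 IHw negb_and inE negbK.
Qed.

(* 'X^i stands for the basis vector e_i. *)
Definition word_act w v : {poly K} :=
  'X^(size w) * \poly_(i < size v) (v`_i * weight i w).

Lemma coef_word_act w v d : (word_act w v)`_d =
  if (d < size w)%N then 0 else v`_(d - size w) * weight (d - size w) w.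
Proof.
rewrite coefXnM; case: ifP => // _; rewrite coef_poly; case: ltnP => // le.
by rewrite nth_default // mul0r.
Qed.

Lemma word_act_linear w : linear (word_act w).
Proof.
move=> c u v; apply/polyP => d; rewrite coefD coefZ !coef_word_act.
case: ifP => _; first by rewrite mulr0 addr0.
by rewrite coefD coefZ mulrDl mulrA.
Qed.

HB.instance Definition _ w :=
  GRing.isLinear.Build K {poly K} {poly K} *:%R
    (word_act w) (word_act_linear w).

Lemma word_act_nil v : word_act [::] v = v.
Proof. by apply/polyP => d; rewrite coef_word_act /= subn0 mulr1. Qed.

Lemma word_act_cat u w v : word_act (u ++ w) v = word_act w (word_act u v).
Proof.
apply/polyP => d; rewrite !coef_word_act size_cat weight_cat subnDAC.
case: (ltnP d (size w)) => [lt|le].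
  by rewrite (leq_trans lt (leq_addl _ _)).
rewrite ltn_subLR // addnC.
case: (ltnP d (size w + size u)) => [_|le']; first by rewrite mul0r.
rewrite -mulrA; congr (_ * (_ * weight _ _)).
by rewrite subnK // leq_subRL.
Qed.

Lemma word_actXn w i : word_act w 'X^i = weight i w *: 'X^(i + size w).
Proof.
apply/polyP => d; rewrite coef_word_act coefZ !coefXn.
case: ltnP => [lt|le].
  by rewrite ltn_eqF ?mulr0 // (leq_trans lt (leq_addl _ _)).
rewrite -(eqn_add2r (size w)) subnK //.
by case: eqP => [->|_]; rewrite ?addnK ?mul0r ?mulr0 // mul1r mulr1.
Qed.

Definition alg_act f v : {poly K} :=
  \sum_(w <- monalg.msupp f) monalg.mcoeff w f *: word_act w v.

Lemma coef_alg_act f v d :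
  (alg_act f v)`_d =
  monalg.mmap idfun (fun w : {fmonom 'I_m} => (word_act w v)`_d) f.
Proof.
by rewrite /alg_act coef_sum monalg.mmapE; apply: eq_bigr => w _; rewrite coefZ.
Qed.

Lemma alg_actDl v : {morph alg_act^~ v : f g / f + g}.
Proof.
by move=> f g; apply/polyP => d; rewrite coefD !coef_alg_act raddfD.
Qed.

Lemma alg_act0l v : alg_act 0 v = 0.
Proof. by apply/polyP => d; rewrite coef_alg_act raddf0 coef0. Qed.

Lemma alg_act_linear f : linear (alg_act f).
Proof.
move=> c u v; rewrite /alg_act scaler_sumr -big_split; apply: eq_bigr => w _ /=.
by rewrite linearP scalerDr !scalerA mulrC.
Qed.

HB.instance Definition _ f :=
  GRing.isLinear.Build K {poly K} {poly K} *:%R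
    (alg_act f) (alg_act_linear f).

Lemma alg_actU c (w : {fmonom 'I_m}) v :
  alg_act << c *g w >> v = c *: word_act w v.
Proof.
by apply/polyP => d; rewrite coef_alg_act monalg.mmapU coefZ.
Qed.

Lemma alg_act_suml (I : Type) (r : seq I) (F : I -> fa) v :
  alg_act (\sum_(i <- r) F i) v = \sum_(i <- r) alg_act (F i) v.
Proof. exact: (big_morph (alg_act^~ v) (alg_actDl v) (alg_act0l v)). Qed.

Lemma alg_actM f g v : alg_act (f * g) v = alg_act g (alg_act f v).
Proof.
rewrite (monalgE f) mulr_suml !alg_act_suml linear_sum.
apply: eq_bigr => u _; rewrite (monalgE g) mulr_sumr /= !alg_act_suml.
apply: eq_bigr => w _.
rewrite malgM_def fgmulUU !alg_actU linearZ /= scalerA mulrC.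
by rewrite -[mmul _ _]/(fmmul _ _) fmmulE /= word_act_cat mulrC.
Qed.

Lemma alg_act1 v : alg_act 1 v = v.
Proof.
by rewrite -[1]/(<< 1 *g fmone _ >>) alg_actU scale1r fmoneE word_act_nil.
Qed.

(** The basis vector of degree [i] is reachable from degree 0. A zero row cuts the module off after
    its degree, which yields truncated modules. *)
Definition alive (i : nat) : bool := all (fun k => lam k != 0) (iota 0 i).

Lemma alive_leq i j : (i <= j)%N -> alive j -> alive i.
Proof.
by move=> /subnKC <-; rewrite /alive iotaD all_cat => /andP [].
Qed.

Lemma iotaS_rcons i n : iota i n.+1 = rcons (iota i n) (i + n).
Proof. by rewrite -cats1 -[n.+1]addn1 iotaD. Qed.

Lemma alive_weight i w : alive i -> weight i w != 0 -> alive (i + size w).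
Proof.
elim: w i => [|a w IHw] i; first by rewrite addn0.
rewrite /= mulf_eq0 negb_or -addSnnS => ai /andP [la]; apply: IHw.
rewrite /alive iotaS_rcons all_rcons -/(alive i) ai andbT.
by apply: contraNneq la => ->; rewrite mxE.
Qed.

Definition live : {pred {poly K}} :=
  fun v => `[< forall i, v`_i != 0 -> alive i >].

Lemma live_zmod : zmod_closed live.
Proof.
split; first by apply/asboolP => i; rewrite coef0 eqxx.
move=> u v /asboolP lu /asboolP lv; apply/asboolP => i.
rewrite coefB; case: (eqVneq u`_i 0) => [->|/lu //].
by rewrite sub0r oppr_eq0 => /lv.
Qed.

HB.instance Definition _ := GRing.isZmodClosed.Build {poly K} live live_zmod.

Lemma liveZ c v : v \in live -> c *: v \in live.
Proof.
move=> /asboolP lv; apply/asboolP => i; rewrite coefZ mulf_eq0 negb_or.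
by case/andP=> _ /lv.
Qed.

Lemma live_Xn i : alive i -> 'X^i \in live.
Proof.
move=> ai; apply/asboolP => j; rewrite coefXn.
by case: (eqVneq j i) => [->//|_]; rewrite eqxx.
Qed.

Lemma live_word_act w v : v \in live -> word_act w v \in live.
Proof.
move=> /asboolP lv; apply/asboolP => d; rewrite coef_word_act.
case: ltnP => [_|le]; first by rewrite eqxx.
rewrite mulf_eq0 negb_or => /andP [/lv /alive_weight wd /wd].
by rewrite subnK.
Qed.

Lemma live_alg_act f v : v \in live -> alg_act f v \in live.
Proof.
by move=> lv; apply: rpred_sum => w _; apply/liveZ/live_word_act.
Qed.

Definition path_space := {v : {poly K} | v \in live}.
HB.instance Definition _ := SubType.on path_space.
HB.instance Definition _ := [Choice of path_space by <:].
HB.instance Definition _ := [SubChoice_isSubZmodule of path_space by <:].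

Variable ws : seq {fmonom 'I_m}.
Hypothesis lam_avoids : avoids ws (fun k => row_support (lam k)).
Local Notation A := (monomial_algebra K ws).

(** Avoidance makes every relation have weight zero at every position, so the action descends to the
    quotient. *)
Lemma alg_act_ideal f v : f \in monomial_ideal ws -> alg_act f v = 0.
Proof.
case/monomial_idealP => s [sws ->].
rewrite alg_act_suml big1_seq // => t /andP [_ /sws tws].
rewrite !alg_actM alg_actU scale1r (_ : word_act _ _ = 0) ?linear0 //.
apply/polyP => d; rewrite coef_word_act coef0; case: ifP => // _.
have := lam_avoids tws (d - size (t.1.2 : seq 'I_m))%N.
by rewrite -weight_eq0 => /eqP ->; rewrite mulr0.
Qed.

Lemma alg_act_repr f v : alg_act (repr (mon_pi ws f)) v = alg_act f v.
Proof.
rewrite -[in LHS](subrK f (repr _)) alg_actDl alg_act_ideal ?add0r //.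
by rewrite -mon_pi_eq mon_piK.
Qed.

Definition path_act (a : A^c) (v : path_space) : path_space :=
  Sub (alg_act (repr (a : A)) (val v)) (live_alg_act _ (valP v)).

Lemma path_actA a b (v : path_space) :
  path_act a (path_act b v) = path_act (a * b) v.
Proof. by apply: val_inj; rewrite /= -alg_actM alg_act_repr. Qed.

Lemma path_act1 : left_id 1 path_act.
Proof. by move=> v; apply: val_inj; rewrite /= alg_act_repr alg_act1. Qed.

Lemma path_actDr : right_distributive path_act +%R.
Proof. by move=> a u v; apply: val_inj; rewrite /= linearD. Qed.

Lemma path_actDl (v : path_space) : {morph path_act^~ v : a b / a + b}.
Proof.
move=> a b; apply: val_inj; rewrite /= -alg_actDl.
by rewrite -[in LHS](mon_piK a) -[in LHS](mon_piK b) -mon_piD alg_act_repr.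
Qed.

Definition path_module : rmodType A :=
  HB.pack path_space (GRing.Zmodule_isLmodule.Build A^c path_space
    path_actA path_act1 path_actDr path_actDl).

Lemma val_path_act (v : path_module) (f : fa) :
  val (v *> mon_pi ws f : path_space) = alg_act f (val (v : path_space)).
Proof. exact: alg_act_repr. Qed.

Lemma val_path_scal (v : path_module) c :
  val (v *> mon_scal ws c : path_space) = c *: val (v : path_space).
Proof.
rewrite val_path_act malg_scalE alg_actU [mone](_ : _ = FMonom [::]) -?fmoneE //.
by rewrite fmoneE word_act_nil.
Qed.

Definition path_grade (d : nat) (v : path_module) : Prop :=
  exists c, val (v : path_space) = c *: 'X^d.

(** In a degree that is not alive the default value 0 is taken. *)
Definition path_vec (d : nat) : path_module := insubd (0 : path_space) 'X^d.

Lemma val_path_vec d : alive d -> val (path_vec d : path_space) = 'X^d.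
Proof. by move=> ad; rewrite insubdK //; apply: live_Xn. Qed.

Lemma path_grade_dead d (v : path_module) :
  ~~ alive d -> path_grade d v -> v = 0.
Proof.
move=> dd [c vE]; apply: (val_inj : injective (val : path_space -> _)).
rewrite vE; have [->|cN0] := eqVneq c 0; first by rewrite scale0r.
have /asboolP /(_ d) := valP (v : path_space).
by rewrite vE coefZ coefXn eqxx mulr1 => /(_ cN0); rewrite (negPf dd).
Qed.

Lemma path_gr_sum (v : path_module) : exists N (u : nat -> path_module),
  (forall i, path_grade i (u i)) /\ v = \sum_(i < N) u i.
Proof.
pose p : {poly K} := val (v : path_space).
have pl i : p`_i *: 'X^i \in live.
  have [->|pN0] := eqVneq p`_i 0; first by rewrite scale0r rpred0.
  by apply/liveZ/live_Xn; have /asboolP := valP (v : path_space); apply.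
pose u i : path_module := (Sub (p`_i *: 'X^i) (pl i) : path_space).
exists (size p), u; split=> [i|]; first by exists p`_i.
apply: (val_inj : injective (val : path_space -> _)).
rewrite [RHS](raddf_sum (val : path_space -> {poly K})).
by rewrite -[LHS]coefK poly_def.
Qed.

Lemma path_grading : is_grading path_grade.
Proof.
split.
- by move=> d; exists 0; rewrite scale0r.
- by move=> d u v [a ua] [b vb]; exists (a + b); rewrite scalerDl -ua -vb.
- move=> d e v a [c vE] [f fe ->].
  exists (\sum_(w <- monalg.msupp f) monalg.mcoeff w f * (c * weight d w)).
  rewrite val_path_act vE /alg_act scaler_suml; apply: eq_big_seq => w.
  rewrite -mcoeff_neq0 => /fe <-.
  by rewrite linearZ /= word_actXn !scalerA mulrA.
- exact: path_gr_sum.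
move=> N u uP; have /choice [c uE] := uP => sum0 i iN.
apply: (val_inj : injective (val : path_space -> _)); rewrite uE.
have : val (\sum_(i < N) u i : path_space) = 0 by rewrite sum0.
rewrite (raddf_sum (val : path_space -> {poly K})) => /(congr1 (coefp i)).
rewrite /= coef0 coef_sum (bigD1 (Ordinal iN)) //= big1 => [|j ji].
  by rewrite uE coefZ coefXn eqxx mulr1 addr0 => ->; rewrite scale0r.
rewrite uE coefZ coefXn (_ : (i == j) = false) ?mulr0 // eq_sym.
exact: negPf ji.
Qed.

(** Choosing a nonzero coordinate at each step gives a monomial carrying the degree 0 vector to a
    nonzero multiple of the degree [d] one; this makes the module cyclic. *)
Lemma path_word d : alive d -> exists2 w, size w = d & weight 0 w != 0.
Proof.
elim: d => [|d IHd] ad; first by exists [::]; rewrite //= oner_eq0.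
have [w wd wN0] := IHd (alive_leq (leqnSn d) ad).
have : lam d != 0 by move: ad; rewrite /alive iotaS_rcons all_rcons => /andP [].
rewrite -row_support_neq0 => /set0Pn [a]; rewrite inE => la.
exists (rcons w a); first by rewrite size_rcons wd.
by rewrite -cats1 weight_cat mulf_neq0 //= mulr1 add0n wd.
Qed.

Lemma path_generated : generated_in_degree0 path_grade.
Proof.
have e0 : val (path_vec 0 : path_space) = 'X^0 by apply: val_path_vec.
exists (path_vec 0); first by exists 1; rewrite e0 scale1r.
have gen d (v : path_module) :
    path_grade d v -> exists a : A, v = path_vec 0 *> a.
  case: (boolP (alive d)) => [/path_word [w wd wN0] [c vE]|dd]; last first.
    by move/(path_grade_dead dd) ->; exists 0; rewrite ract0.
  exists (mon_pi ws << c / weight 0 w *g FMonom w >>).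
  apply: (val_inj : injective (val : path_space -> _)).
  by rewrite val_path_act e0 alg_actU word_actXn scalerA divfK // add0n wd vE.
move=> v; have [N [u [uP ->]]] := path_gr_sum v.
have /choice [a aP] := fun i => gen i _ (uP i).
exists (\sum_(i < N) a i); rewrite /ract.
rewrite (@scaler_suml A^c path_module (path_vec 0) _ (index_enum _) xpredT
           (fun i : 'I_N => a i)).
by apply: eq_bigr => i _; rewrite aP.
Qed.

Lemma path_spans_line d : alive d -> spans_line (path_grade d) (path_vec d).
Proof.
move=> ad; have eE := val_path_vec ad; split.
- by exists 1; rewrite eE scale1r.
- move=> e0; have /polyP /(_ d) : 'X^d = 0 :> {poly K} by rewrite -eE e0.
  by rewrite coefXn eqxx coef0 => /eqP; rewrite oner_eq0.
move=> v [c vE]; exists c; apply: (val_inj : injective (val : path_space -> _)).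
by rewrite vE val_path_scal eE.
Qed.

Lemma path_step d j : alive d.+1 ->
  path_vec d *> mon_gen K ws j = path_vec d.+1 *> mon_scal ws (lam d 0 j).
Proof.
move=> ad; apply: (val_inj : injective (val : path_space -> _)).
rewrite val_path_scal val_path_act !val_path_vec ?(alive_leq (leqnSn d) ad) //.
by rewrite alg_actU scale1r fmuE word_actXn /= mulr1 addn1.
Qed.

End PathModule.

(** * The two varieties of point modules *)

Section Varieties.
Context (F : fieldType) (m n : nat) (ws : seq {fmonom 'I_m}).
Implicit Types x : @mpoint F m n.

Lemma nth_supports x (i : 'I_n.+1) :
  nth set0 (supports x) i = proj_support (mp_coords x i).
Proof. by rewrite -tnth_nth tnth_mktuple. Qed.

Lemma step_support (K : fieldType) (M : rmodType (monomial_algebra K ws))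
    (e : nat -> M) i (L : proj_space K m) j :
  step_recorded e i L -> j \in proj_support L ->
  exists2 c, c != 0 & e i *> mon_gen K ws j = e i.+1 *> mon_scal ws c.
Proof.
case=> l /hom_coords_support <- lP; rewrite inE => lj.
by exists (l 0 j).
Qed.

Section PathOfCoordinates.
Variables (x : @mpoint F m n) (tail : nat -> 'rV[mp_field x]_m).
Local Notation K := (mp_field x).

(** The tail is zero to obtain a truncated module and nowhere zero to obtain a point module. *)
Definition path_coords (k : nat) : 'rV[K]_m :=
  if insub k is Some i then vpick (val (mp_coords x (i : 'I_n.+1))) else tail k.

Lemma path_coords_ord (i : 'I_n.+1) :
  path_coords i = vpick (val (mp_coords x i)).
Proof. by rewrite /path_coords valK. Qed.

Lemma path_coords_tail k : (n < k)%N -> path_coords k = tail k.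
Proof. by move=> nk; rewrite /path_coords insubN // -leqNgt. Qed.

Lemma path_coords_support (T : nat -> {set 'I_m}) :
  (forall i : 'I_n.+1, T i = proj_support (mp_coords x i)) ->
  (forall k, (n < k)%N -> T k = row_support (tail k)) ->
  forall k, row_support (path_coords k) = T k.
Proof.
move=> Tx Tt k; case: (ltnP n k) => [nk|kn].
  by rewrite path_coords_tail ?Tt.
pose i : 'I_n.+1 := Ordinal (kn : k < n.+1)%N.
by rewrite (path_coords_ord i) (Tx i).
Qed.

End PathOfCoordinates.

Lemma truncated_point_varietyP x :
  truncated_point_variety ws x <-> safe_word ws (supports x).
Proof.
split=> [[M [Mg [[_ _ _ _] [e [eP eS]]]]]|[_ av]].
  split; first exact: nonempty_supports.
  have nf (w : {fmonom 'I_m}) i : w \in ws -> (i + size w <= n.+1)%N ->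
      ~~ fits (nth set0 (supports x)) i w.
    apply: (@not_fits_relation _ _ _ M n.+1 e) => [k /eP []//|k j kn].
    rewrite (nth_supports x (Ordinal kn)); apply: step_support.
    exact: (eS (Ordinal kn)).
  move=> w wws i; apply/negP => fw.
  (* An empty relation fits at every [i], even past the end; it is excluded at position 0. *)
  have [w0|wN0] := eqVneq (w : seq 'I_m) [::].
    by have := nf w 0%N wws; rewrite w0 => /(_ isT).
  have := fits_bound wN0 fw; rewrite size_tuple => le.
  by have := nf w i wws le; rewrite fw.
pose lam := path_coords (x := x) (fun=> 0).
have lamE : forall k, row_support (lam k) = nth set0 (supports x) k.
  apply: path_coords_support => [i|k nk]; first exact: nth_supports.
  rewrite nth_default ?size_tuple //; apply/esym/eqP.
  by apply: contraT; rewrite row_support_neq0 eqxx.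
have lam_avoids : avoids ws (fun k => row_support (lam k)).
  by apply: avoids_sub av => k; rewrite lamE.
have lam_alive d : alive lam d = (d <= n.+1)%N.
  apply/allP/idP => [al|dn k].
    rewrite leqNgt; apply/negP => dn.
    have /al : n.+1 \in iota 0 d by rewrite mem_iota.
    by rewrite /lam path_coords_tail ?eqxx.
  rewrite mem_iota add0n => /= kd; have kn := leq_trans kd dn.
  rewrite -row_support_neq0 lamE (nth_supports x (Ordinal kn)).
  exact: proj_support_neq0.
exists (path_module lam_avoids), (@path_grade _ _ _ _ lam_avoids); split.
  split; first exact: path_grading.
  - exact: path_generated.
  - move=> d dn; exists (path_vec lam_avoids d).
    by apply: path_spans_line; rewrite lam_alive.
  - by move=> d v nd; apply: path_grade_dead; rewrite lam_alive -ltnNge.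
exists (path_vec lam_avoids); split=> [i iN|i].
  by apply: path_spans_line; rewrite lam_alive.
exists (lam i) => [|j]; last by apply: path_step; rewrite lam_alive.
by rewrite /lam path_coords_ord; exact: hom_coords_vpick.
Qed.

Lemma point_varietyP x :
  point_variety ws x <-> forever (safe_word ws) (supports x).
Proof.
rewrite forever_safeP; split.
  case=> M [Mg [S [_ [e [eP eS]] SL]]].
  exists (fun k => proj_support (S k)); split=> [k|w wws i|k].
  - exact: proj_support_neq0.
  - apply: (@not_fits_relation _ _ _ M (i + size w) e) => // [k _|k j _].
      by have [] := eP k.
    exact: step_support.
  - by rewrite size_tuple => kn; rewrite (nth_supports x (Ordinal kn)) SL.
case=> T [TN0 av Tx].
(* Beyond [n] only the supports are prescribed, and 0-1 vectors realize them. *)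
pose lam := path_coords (x := x) (fun k => \row_j (j \in T k)%:R).
have lamE : forall k, row_support (lam k) = T k.
  apply: path_coords_support => [i|k nk].
    by rewrite -nth_supports Tx // size_tuple.
  apply/setP => j; rewrite inE mxE.
  by case: (j \in T k); rewrite ?oner_neq0 ?eqxx.
have lam_avoids : avoids ws (fun k => row_support (lam k)).
  by apply: avoids_sub av => k; rewrite lamE.
have lamN0 k : lam k != 0 by rewrite -row_support_neq0 lamE.
have lam_alive d : alive lam d by apply/allP => k _; exact: lamN0.
have /choice [S SP] := fun k => proj_of_row (lamN0 k).
exists (path_module lam_avoids), (@path_grade _ _ _ _ lam_avoids), S; split.
- split; [exact: path_grading|exact: path_generated|move=> d].
  by exists (path_vec lam_avoids d); apply: path_spans_line.
- exists (path_vec lam_avoids); split=> i; first exact: path_spans_line.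
  by exists (lam i) => // j; apply: path_step.
move=> i; apply: val_inj; rewrite -(SP i) /lam path_coords_ord.
exact/esym/hom_coords_vpick.
Qed.

Lemma safe_below (t t' : n.+1.-tuple {set 'I_m}) :
  nonempty_word t -> below t t' -> safe_word ws t' -> safe_word ws t.
Proof.
move=> tN0 /below_tupleP tt' [_ av]; split=> //; apply: avoids_sub av => k.
case: (ltnP k n.+1) => kn; last by rewrite nth_default ?size_tuple ?sub0set.
by have := tt' (Ordinal kn); rewrite !(tnth_nth set0).
Qed.

(** The continuation of the larger word also serves the smaller one. *)
Lemma forever_safe_below (t t' : n.+1.-tuple {set 'I_m}) :
  nonempty_word t -> below t t' ->
  forever (safe_word ws) t' -> forever (safe_word ws) t.
Proof.
move=> tN0 /below_tupleP tt' [c cP]; exists c => N; have [cN0 av] := cP N.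
split; first by move: cN0; rewrite !all_cat => /andP [_ ->]; rewrite andbT.
apply: avoids_sub av => k; rewrite !nth_cat !size_tuple.
case: (ltnP k n.+1) => // kn.
by have := tt' (Ordinal kn); rewrite !(tnth_nth set0).
Qed.

End Varieties.

Theorem theorem8p2 (F : fieldType) (m : nat) (ws : seq {fmonom 'I_m}) :
  (exists a : nat -> nat,
     (forall n : nat, num_components (@point_variety F m n ws) (a n)) /\
     rational_series (fun n : nat => (a n)%:R)) /\
  (exists abar : nat -> nat,
     (forall n : nat, num_components (@truncated_point_variety F m n ws) (abar n)) /\
     rational_series (fun n : nat => (abar n)%:R)).
Proof.
have subset_refl : reflexive (fun a b : {set 'I_m} => a \subset b).
  by move=> a; exact: subxx.
split.
  (* The count stays open until the rationality goal fixes it as the number of maximal words of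
     length [n.+1]. *)
  eexists; split=> [n|]; last first.
    apply: rational_recognizable; apply: (recognizable_maximal subset_refl).
    exact: recognizable_forever (recognizable_safe ws).
  apply: num_components_strata.
  - exact: point_varietyP.
  - by move=> t [c /(_ 0%N)]; rewrite cats0 => -[].
  - exact: forever_safe_below.
eexists; split=> [n|]; last first.
  apply: rational_recognizable; apply: (recognizable_maximal subset_refl).
  exact: (recognizable_safe ws).
apply: num_components_strata.
- exact: truncated_point_varietyP.
- by move=> t [].
- exact: safe_below.
Qed.
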